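(* Let $\Omega$ be an infinite compact metric space and let $T:\Omega\to\Omega$ be an invertible continuous map which is uniquely ergodic, with unique invariant Borel probability measure $\mu$; assume that $\mu$ is regular and continuous (non-atomic) and has full support. Suppose that $\psi:\mathbb N\to\mathbb N$ satisfies $\psi(n)=o(n)$. Then there exists a residual set $\mathcal R\subset\mathcal C_0(\Omega)$ such that for every $f\in\mathcal R$ the set $$\mathcal E_\psi(f)=\left\{x\in\Omega:\ \limsup_{n\to\infty}\frac{|S_{n,T}f(x)|}{\psi(n)}=+\infty\right\}$$ is residual in $\Omega$ and of full $\mu$-measure in $\Omega$.
   Context: $\mathbb N=\{1,2,3,\dots\}$. Fix a scalar field, $\mathbb R$ or $\mathbb C$ (either is allowed). $\mathcal C_0(\Omega)$ is the space of continuous scalar-valued functions $f$ on $\Omega$ with $\int_\Omega f\,d\mu=0$, equipped with the sup norm $\|\cdot\|_\infty$. The Birkhoff sums are $S_{n,T}f(x)=\sum_{k=0}^{n-1}f(T^kx)$. A subset of a complete metric space is residual if it contains a countable intersection of dense open sets. Full measure means $\mu$-measure $1$. *)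

(* Defs.v *)
From HB Require Import structures.
From mathcomp Require Import all_boot all_order all_algebra.
From mathcomp Require Import complex ring lra.
From mathcomp Require Import all_classical all_reals all_analysis.
From mathcomp Require Import borel_hierarchy.

Set Implicit Arguments.
Unset Strict Implicit.
Unset Printing Implicit Defensive.

Import Order.TTheory GRing.Theory Num.Theory.
Import numFieldNormedType.Exports.

Local Open Scope classical_set_scope.
Local Open Scope ring_scope.

(* The base point is only there because measurable types are pointed in
   MathComp-Analysis; any nonempty metric space can be given one. *)
#[short(type="pmetricType")]
HB.structure Definition PointedMetric (K : numDomainType) :=
  {M of Metric K M & isPointed M}.

Notation borel Omega := (g_sigma_algebraType (@open Omega)).

Inductive scalar_kind := RealScalars | ComplexScalars.

Definition scalar_field (R : realType) (k : scalar_kind) : numFieldType :=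
  match k with RealScalars => R | ComplexScalars => R[i] end.

(* The norm of a numFieldType takes its values in that type; sabs is the same
   modulus seen as an element of R. *)
Definition sabs (R : realType) (k : scalar_kind) : scalar_field R k -> R :=
  match k with
  | RealScalars => fun z : R => `|z|
  | ComplexScalars => fun z : R[i] => complex.Re `|z|
  end.

Definition sintegral (R : realType) (k : scalar_kind) (d : measure_display)
    (X : measurableType d) (mu : {measure set X -> \bar R}) :
    (X -> scalar_field R k) -> scalar_field R k :=
  match k with
  | RealScalars => fun f : X -> R => \int[mu]_x f x
  | ComplexScalars => fun f : X -> R[i] =>
      Complex (\int[mu]_x complex.Re (f x)) (\int[mu]_x complex.Im (f x))
  end.

Definition supnorm (R : realType) (k : scalar_kind) (X : Type)
    (f : X -> scalar_field R k) : R := sup (range (fun x => sabs (f x))).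

(* The compactness proof is a parameter because the sup norm is finite, hence
   induces a metric, only when Omega is compact. *)
Record C0 (R : realType) (k : scalar_kind) (Omega : pmetricType R)
    (cOmega : compact [set: Omega]) (mu : probability (borel Omega) R) := MkC0 {
  C0_fun :> Omega -> scalar_field R k ;
  C0_continuous : continuous C0_fun ;
  C0_mean0 : sintegral mu C0_fun = 0 }.

Lemma sabs_ge0 (R : realType) k (z : scalar_field R k) : 0 <= sabs z.
Proof.
case: k z => /= z; first exact: normr_ge0.
by have := normr_ge0 z; rewrite lecE => /andP[].
Qed.

Lemma sabs0 (R : realType) k : sabs (0 : scalar_field R k) = 0.
Proof.
case: k; first exact: (normr0 R).
by rewrite /sabs (normr0 R[i]).
Qed.

Lemma sabs_eq0 (R : realType) k (z : scalar_field R k) : sabs z = 0 -> z = 0.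
Proof.
case: k z => /= z; first exact: normr0_eq0.
by case: z => a b /= h; apply/normr0_eq0; rewrite normc_def /= h.
Qed.

Lemma sabsB (R : realType) k (z w : scalar_field R k) : sabs (z - w) = sabs (w - z).
Proof.
case: k z w => z w; first exact: (@distrC R R z w).
by congr (complex.Re _); exact: (@distrC _ R[i] z w).
Qed.

Lemma sabsD (R : realType) k (z w : scalar_field R k) :
  sabs (z + w) <= sabs z + sabs w.
Proof.
case: k z w => z w; first exact: (@ler_normD _ R z w).
by have := @ler_normD _ R[i] z w; rewrite lecE => /andP[].
Qed.

Lemma nbhs_sabs (R : realType) k (z : scalar_field R k) (e : R) : 0 < e ->
  nbhs z [set w | sabs (z - w) < e].
Proof.
move=> e0; case: k z => /= z.
  by apply/nbhs_ballP; exists e.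
apply/nbhs_ballP; exists (real_complex R e); first by rewrite /= ltcR.
move=> w; rewrite /ball /= => zw.
by move: zw; rewrite ltcE /= => /andP[].
Qed.

Section C0_metric.
Variables (R : realType) (k : scalar_kind) (Omega : pmetricType R).
Variables (cOmega : compact [set: Omega]) (mu : probability (borel Omega) R).
Local Notation C0 := (C0 k cOmega mu).

HB.instance Definition _ := gen_eqMixin C0.
HB.instance Definition _ := gen_choiceMixin C0.

Lemma C0_ext (f g : C0) : f =1 g -> f = g.
Proof.
case: f g => f cf mf [g cg mg] /= /funext fg; subst g.
by congr MkC0; exact: Prop_irrelevance.
Qed.

Lemma C0_has_ubound (f g : C0) :
  has_ubound (range (fun x => sabs (f x - g x))).
Proof.
have cfg : continuous (fun x => sabs (f x - g x)).
  move=> x; apply/cvgrPdist_lt => e e0.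
  have e20 : 0 < e / 2 by rewrite divr_gt0.
  have nf : \forall y \near x, sabs (f x - f y) < e / 2.
    exact: (C0_continuous (c := f) (nbhs_sabs (f x) e20)).
  have ng : \forall y \near x, sabs (g x - g y) < e / 2.
    exact: (C0_continuous (c := g) (nbhs_sabs (g x) e20)).
  near=> y.
  have fy : sabs (f x - f y) < e / 2 by near: y.
  have gy : sabs (g x - g y) < e / 2 by near: y.
  have := sabsD (f y - g y) ((f x - f y) + (g y - g x)).
  have := sabsD (f x - g x) ((f y - f x) + (g x - g y)).
  have := sabsD (f x - f y) (g y - g x).
  have := sabsD (f y - f x) (g x - g y).
  have -> : f x - g x + (f y - f x + (g x - g y)) = f y - g y.
    by ring.
  have -> : f y - g y + (f x - f y + (g y - g x)) = f x - g x.
    by ring.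
  rewrite (sabsB (f y) (f x)) (sabsB (g y) (g x)) => h1 h2 h3 h4.
  by rewrite ltr_norml ltrBlDr ltrBrDr; apply/andP; split; lra.
have /compact_bounded[M [_ hM]] :
    compact (range (fun x : Omega => sabs (f x - g x) : R^o)).
  by apply: continuous_compact => //; exact: continuous_subspaceT.
exists (M + 1) => _ [x _ <-].
apply: le_trans (ler_norm _) _.
by apply: (hM (M + 1)); [rewrite ltrDl | exists x].
Unshelve. all: by end_near. Qed.

Let dist (f g : C0) : R := supnorm (fun x => f x - g x).

Let le_dist (f g : C0) x : sabs (f x - g x) <= dist f g.
Proof. by apply: ub_le_sup; [exact: C0_has_ubound | exists x]. Qed.

Let dist_le (f g : C0) r :
  (forall x, sabs (f x - g x) <= r) -> dist f g <= r.
Proof.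
move=> h; apply: ge_sup; first by exists (sabs (f point - g point)); exists point.
by move=> _ [x _ <-].
Qed.

Let distxx f : dist f f = 0.
Proof.
apply/le_anti/andP; split.
  by apply: dist_le => x; rewrite subrr sabs0.
exact: le_trans (sabs_ge0 _) (le_dist f f point).
Qed.

Let dist_positivity f g : dist f g = 0 -> f = g.
Proof.
move=> fg0; apply: C0_ext => x; apply/eqP; rewrite -subr_eq0; apply/eqP.
by apply/sabs_eq0/le_anti; rewrite sabs_ge0 -fg0 le_dist.
Qed.

Let dist_sym f g : dist f g = dist g f.
Proof.
by congr (sup _); apply: eq_imagel => x _; exact: sabsB.
Qed.

Let dist_triangle g f h : dist f h <= dist f g + dist g h.
Proof.
apply: dist_le => x; rewrite -(subrKA (g x)).
by rewrite (le_trans (sabsD _ _))// lerD.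
Qed.

HB.instance Definition _ := @isMetric.Build R C0 dist
  distxx dist_positivity dist_sym dist_triangle.

Lemma C0_mdistE (f g : C0) : mdist f g = supnorm (fun x => f x - g x).
Proof. by []. Qed.

End C0_metric.

Definition residual (X : topologicalType) (A : set X) : Prop :=
  exists2 G, Gdelta_dense G & G `<=` A.

Section dynamics.
Variables (R : realType) (Omega : pmetricType R).
Implicit Types (T : Omega -> Omega) (mu nu : probability (borel Omega) R).

Definition invariant_measure T nu : Prop :=
  forall A : set (borel Omega), measurable A -> nu (T @^-1` A) = nu A.

(* A measure is a total function on sets, of which only the values on
   measurable sets are meaningful; this is why nu and mu are compared there. *)
Definition uniquely_ergodic T mu : Prop :=
  invariant_measure T mu /\
  forall nu, invariant_measure T nu ->
    forall A : set (borel Omega), measurable A -> nu A = mu A.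

Definition regular_measure mu : Prop :=
  forall A : set (borel Omega), measurable A ->
    mu A = ereal_inf [set mu U | U in [set U : set Omega | open U /\ A `<=` U]]
    /\
    mu A = ereal_sup
      [set mu C | C in [set C : set Omega | compact C /\ C `<=` A]].

Definition continuous_measure mu : Prop := forall x : Omega, mu [set x] = 0%E.

Definition support_measure mu : set Omega :=
  [set x | forall U : set Omega, open U -> U x -> (0 < mu U)%E].

Definition full_support mu : Prop := support_measure mu = [set: Omega].

Definition full_measure mu (A : set Omega) : Prop :=
  measurable (A : set (borel Omega)) /\ mu A = 1%E.

Definition birkhoff_sum (k : scalar_kind) T (f : Omega -> scalar_field R k) (n : nat)
  (x : Omega) : scalar_field R k := \sum_(i < n) f (iter i T x).

Definition growth_set (k : scalar_kind) T (psi : nat -> nat)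
    (f : Omega -> scalar_field R k) : set Omega :=
  [set x | limn_esup
    (fun n => (sabs (birkhoff_sum T f n x) / (psi n)%:R)%:E) = +oo%E].

End dynamics.

(* Main.v *)
Require Import Defs.
From HB Require Import structures.
From mathcomp Require Import all_boot all_order all_algebra.
From mathcomp Require Import complex ring lra.
From mathcomp Require Import all_classical all_reals all_analysis.
From mathcomp Require Import borel_hierarchy.

Set Implicit Arguments.
Unset Strict Implicit.
Unset Printing Implicit Defensive.

Import Order.TTheory GRing.Theory Num.Theory.
Import numFieldNormedType.Exports.

Local Open Scope classical_set_scope.
Local Open Scope ring_scope.

(* Let L_i(f) be the open set of the x such that |S_n f(x)| > i psi(n) for some
   n > i; the growth set of f is the intersection of the L_i(f).  If every
   L_i(f) has measure 1, it is dense because mu has full support, and the growth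
   set is residual and of full measure.  So it is enough that, for each i, the f
   with mu(L_i(f)) > 1 - 1/(i+1) form a dense open set.

   Openness is continuity of mu from below.  For density, unique ergodicity and
   non-atomicity give a set D with mu(D) between 1/4 and 1/2 that is almost
   invariant under T; smoothing and centering its indicator gives a continuous
   real function u of mean zero with |u| <= 1 and |S_n u| >= n/8 outside a set of
   small measure, where n was fixed beforehand with psi(n)/n small.  Among the
   many perturbations f + t u of a given f, with t in a fixed finite set of small
   reals, one must then lie in the required set, since at most points at most one
   value of t can make |S_n f(x) + t S_n u(x)| small. *)

(** * Continuity, union bounds and pigeonhole for real-valued probabilities *)

Section real_valued_probability.
Context d (X : measurableType d) (R : realType) (P : probability X R).
Implicit Types A B : set X.

(** Real values, rather than extended ones, let measure estimates be closed by linear arithmetic. *)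
Definition pr A : R := fine (P A).

Lemma prE A : measurable A -> P A = (pr A)%:E.
Proof. by move=> mA; rewrite /pr fineK// fin_num_measure. Qed.

Lemma pr_le A B : measurable A -> measurable B -> A `<=` B -> pr A <= pr B.
Proof.
by move=> mA mB AB; rewrite -lee_fin -!prE// le_measure// inE.
Qed.

Lemma pr_le1 A : measurable A -> pr A <= 1.
Proof. by move=> mA; rewrite -lee_fin -prE// probability_le1. Qed.

Lemma prU A B : measurable A -> measurable B -> pr (A `|` B) <= pr A + pr B.
Proof.
move=> mA mB; rewrite -lee_fin EFinD -!prE//; last exact: measurableU.
by rewrite measureU2.
Qed.

Lemma prC A : measurable A -> pr (~` A) = 1 - pr A.
Proof.
move=> mA; apply: EFin_inj; rewrite -prE; last exact: measurableC.
by rewrite probability_setC// prE// EFinB.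
Qed.

Lemma prD A B : measurable A -> measurable B -> B `<=` A ->
  pr (A `\` B) = pr A - pr B.
Proof.
move=> mA mB BA; apply: EFin_inj; rewrite -prE; last exact: measurableD.
have -> : P (A `\` B) = (P A - P (A `&` B))%E.
  by apply: measureD => //; rewrite ltey_eq fin_num_measure.
by rewrite (setIidr BA) !prE// EFinB.
Qed.

Lemma pr_bigcup_gt (F : nat -> set X) c : (forall n, measurable (F n)) ->
  {homo F : m n / (m <= n)%N >-> m `<=` n} ->
  c < pr (\bigcup_n F n) -> exists n, c < pr (F n).
Proof.
move=> mF ndF.
have mU : measurable (\bigcup_n F n) by exact: bigcup_measurable.
have : P \o F @ \oo --> P (\bigcup_n F n).
  by apply: nondecreasing_cvg_mu => // m n /ndF; rewrite subsetEset.
rewrite prE// => /fine_cvgP[_] /cvgr_gt h /h[N _ /(_ N)] /= cN.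
by exists N; apply: cN => /=.
Qed.

Lemma pr_bigcap_lt (F : nat -> set X) c : (forall n, measurable (F n)) ->
  {homo F : m n / (m <= n)%N >-> n `<=` m} ->
  pr (\bigcap_n F n) < c -> exists n, pr (F n) < c.
Proof.
move=> mF ndF h.
have [|||n] := @pr_bigcup_gt (fun n => ~` F n) (1 - c).
- by move=> n; exact: measurableC.
- by move=> m n /ndF; exact: subsetC.
- by rewrite -setC_bigcap prC ?ltrD2l ?ltrN2//; exact: bigcapT_measurable.
by rewrite prC// ltrD2l ltrN2; exists n.
Qed.

(** If all [J] disjoint sets had measure above 1/J, their union would have measure above 1. *)
Lemma pr_trivIset_pigeonhole (F : nat -> set X) J : (0 < J)%N ->
  (forall n, measurable (F n)) -> trivIset `I_J F ->
  exists2 j, (j < J)%N & pr (F j) <= J%:R^-1.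
Proof.
move=> J0 mF tF; apply: contrapT => /forall2NP nex.
have mU : measurable (\big[setU/set0]_(j < J) F j) by exact: bigsetU_measurable.
have lt1 : P (\big[setU/set0]_(j < J) F j) = (\sum_(j < J) pr (F j))%:E.
  rewrite (@measure_semi_additive_ord_I _ _ _ P F J (fun k _ => mF k) tF mU).
  by rewrite -sumEFin; apply: eq_bigr => j _; rewrite -prE.
have : (\sum_(j < J) pr (F j) <= 1).
  by rewrite -lee_fin -lt1 probability_le1.
apply/negP; rewrite -ltNge.
have -> : 1 = \sum_(j < J) (J%:R^-1 : R).
  by rewrite sumr_const card_ord -[RHS]mulr_natl mulfV// pnatr_eq0 -lt0n.
apply: ltr_sum => [|j _]; first by apply/hasP;
  exists (Ordinal J0); rewrite ?mem_index_enum.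
by rewrite ltNge; apply/negP; case: (nex j) => //; rewrite ltn_ord.
Qed.

Lemma pr_bigcup_ord (F : nat -> set X) n c : (forall i, measurable (F i)) ->
  (forall i, pr (F i) <= c) -> pr (\big[setU/set0]_(i < n) F i) <= n%:R * c.
Proof.
move=> mF Fc; elim: n => [|n IH]; first by rewrite big_ord0 /pr measure0 mul0r.
rewrite big_ord_recr /= (le_trans (prU _ _))//; first exact: bigsetU_measurable.
by rewrite -natr1 mulrDl mul1r lerD.
Qed.

End real_valued_probability.

(** * Borel measurability of open sets, preimages and continuous functions *)

Section borel_sets.
Context (R : realType) (X : pmetricType R).

Lemma borel_open (A : set X) : open A -> measurable (A : set (borel X)).
Proof. by move=> oA; apply: sub_sigma_algebra. Qed.

Lemma borel_closed (A : set X) : closed A -> measurable (A : set (borel X)).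
Proof.
move=> cA; rewrite -[A]setCK; apply: measurableC.
by apply: borel_open; rewrite openC.
Qed.

Lemma borel_preimage (T : X -> X) (A : set X) : continuous T ->
  measurable (A : set (borel X)) -> measurable (T @^-1` A : set (borel X)).
Proof.
move=> cT mA; rewrite -[_ @^-1` _]setTI.
have /(_ measurableT A mA) : measurable_fun [set: borel X] (T : borel X -> borel X).
  apply: (@measurability _ _ _ (borel X) _ _ (@open X : set (set (borel X))) erefl).
  move=> _ [B oB <-]; rewrite setTI; apply: borel_open.
  by move/continuousP : cT; apply.
by [].
Qed.

Lemma continuous_borel_measurable (f : X -> R) : continuous f ->
  measurable_fun [set: borel X] (f : borel X -> R).
Proof.
move=> cf; apply: (@measurability _ _ (borel X) R setT f _
  (measurable_realfun.RGenOpens.measurableE R)).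
move=> _ [_ [a [b ->]] <-]; rewrite setTI; apply: borel_open.
by move/continuousP : cf; apply; exact: interval_open.
Qed.

Lemma continuous_iter (T : X -> X) n : continuous T -> continuous (iter n T).
Proof.
move=> cT; elim: n => [x|n IH x]; first exact: cvg_id.
exact: (continuous_comp (IH x) (cT _)).
Qed.

End borel_sets.

(** * Ergodicity deduced from unique ergodicity *)

Section ergodicity.
Context (R : realType) (X : pmetricType R) (T : X -> X).
Context (mu : probability (borel X) R).
Hypotheses (cT : continuous T) (ueT : uniquely_ergodic T mu).
Local Notation m := (pr mu).
Local Notation meas A := (measurable (A : set (borel X))).

Lemma pr_preimage (A : set X) : meas A -> m (T @^-1` A) = m A.
Proof. by move=> mA; rewrite /pr (ueT.1 A mA). Qed.

Lemma iter_preimageS n (A : set X) :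
  iter n.+1 T @^-1` A = T @^-1` (iter n T @^-1` A).
Proof. by apply/seteqP; split => x; rewrite /preimage/= -iterSr. Qed.

Lemma borel_iter n (A : set X) : meas A -> meas (iter n T @^-1` A).
Proof. by move=> mA; apply: borel_preimage => //; exact: continuous_iter. Qed.

Lemma pr_iter n (A : set X) : meas A -> m (iter n T @^-1` A) = m A.
Proof.
move=> mA; elim: n => [//|n IH]; rewrite iter_preimageS pr_preimage//.
exact: borel_iter.
Qed.

(* The normalized restriction of mu to E is another invariant measure. *)
Lemma ergodic_subinvariant (E : set X) : meas E -> T @^-1` E `<=` E ->
  0 < m E -> m E = 1.
Proof.
move=> mE TE E0.
have mTE : meas (T @^-1` E) by exact: borel_preimage.
pose nu : probability (borel X) R := mnormalize (mrestr mu mE) mu.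
have nuE A : meas A -> nu A = (m (A `&` E) / m E)%:E.
  move=> mA; rewrite /nu /= /mnormalize /= /mrestr setTI.
  rewrite prE// ifF; last by rewrite eqe gt_eqF//= orbF.
  by rewrite prE//; exact: measurableI.
(* Invariance makes the set of points of [E] that leave [E] under [T] null. *)
have D0 : m (E `\` T @^-1` E) = 0 by rewrite prD// pr_preimage// subrr.
(* Uniqueness is tested on the complement of [E]: [nu] vanishes there, hence so does [mu]. *)
have /ueT.2/(_ (~` E) (measurableC mE)) : invariant_measure T nu.
  move=> A mA; have mTA : meas (T @^-1` A) by exact: borel_preimage.
  rewrite !nuE//; congr ((_ / _)%:E).
  have mAE : meas (A `&` E) by exact: measurableI.
  rewrite -[RHS]pr_preimage//.
  have mTAE : meas (T @^-1` A `&` E) by exact: measurableI.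
  have mTTAE : meas (T @^-1` (A `&` E)) by exact: borel_preimage.
  apply/le_anti/andP; split; last first.
    by apply: pr_le => // x [Ax Ex]; split => //; exact: TE.
  have mD : meas (E `\` T @^-1` E) by exact: measurableD.
  (* A point of [E] with image in [A] either stays in [E], so its image is in both sets, or lies in
     the null set of [D0]. *)
  have /le_trans : m (T @^-1` A `&` E) <=
      m (T @^-1` (A `&` E) `|` (E `\` T @^-1` E)).
    apply: pr_le => //; first exact: measurableU.
    move=> x [Ax Ex]; have [TEx|nTEx] := pselect (E (T x)); first by left.
    by right.
  by apply; rewrite (le_trans (prU _ _ _))// D0 addr0.
rewrite nuE ?setICl; last exact: measurableC.
rewrite (prE _ (measurableC mE)) prC// /pr measure0 mul0r => -[] /esym/eqP.
by rewrite subr_eq0 => /eqP.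
Qed.

(** The preimage of the union is the union over k >= 1, hence smaller, so the union is subinvariant;
    it contains [A], hence has positive measure. *)
Lemma pr_bigcup_preimage (A : set X) : meas A -> 0 < m A ->
  m (\bigcup_k (iter k T @^-1` A)) = 1.
Proof.
move=> mA A0.
have mU : meas (\bigcup_k (iter k T @^-1` A)).
  by apply: bigcup_measurable => k _; exact: borel_iter.
apply: ergodic_subinvariant => //.
  by move=> x [k _ Akx]; exists k.+1 => //; rewrite /preimage/= -iterS iterSr.
by rewrite (lt_le_trans A0)// pr_le// => x Ax; exists 0%N.
Qed.

End ergodicity.

(** * Almost invariant sets and continuous functions with large Birkhoff sums *)

Section almost_invariant.
Context (R : realType) (X : pmetricType R) (cX : compact [set: X]) (T : X -> X).
Context (mu : probability (borel X) R).
Hypotheses (cT : continuous T) (ueT : uniquely_ergodic T mu).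
Hypotheses (regmu : regular_measure mu) (contmu : continuous_measure mu).
Hypothesis (suppmu : full_support mu).
Local Notation m := (pr mu).
Local Notation meas A := (measurable (A : set (borel X))).

Lemma open_pr_gt0 (U : set X) x : open U -> U x -> 0 < m U.
Proof.
move=> oU Ux; have : support_measure mu x by rewrite suppmu.
by move=> /(_ U oU Ux); rewrite prE ?lte_fin//; exact: borel_open.
Qed.

(** Open balls around the base point shrink to a singleton, which is null since [mu] has no atoms;
    full support keeps each of them of positive measure. *)
Lemma exists_small_open (a : R) : 0 < a ->
  exists U : set X, [/\ open U, 0 < m U & m U < a].
Proof.
move=> a0; pose F n : set X := (ball (point : X) n.+1%:R^-1)°.
have oF n : open (F n) by exact: open_interior.
have capF : \bigcap_n F n = [set point].
  apply/seteqP; split => [x Fx|_ ->]; last first.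
    by move=> n _; exact: nbhsx_ballx.
  apply/eqP; rewrite eq_sym -[_ == _]negbK -mdist_gt0; apply/negP => d0.
  have [n _ nd] := near_infty_natSinv_lt (PosNum d0).
  have /interior_subset := Fx n I; rewrite ballEmdist /=.
  by move/lt_trans/(_ (nd n (leqnn n))); rewrite ltxx.
have [n|i j ij||n Fn] := @pr_bigcap_lt _ _ _ mu F a.
- exact: borel_open.
- apply: interiorS; apply: le_ball.
  by rewrite lef_pV2 ?posrE// ler_nat.
- by rewrite capF /pr contmu.
exists (F n); split => //; apply: (@open_pr_gt0 _ point) => //.
exact: nbhsx_ballx.
Qed.

(* With A open of small measure, the sets D_n = T^-0 A U ... U T^-(n-1) A grow
   to measure 1 by steps of at most m A, and T^-1 D_n differs from D_n only
   inside A and T^-n A. *)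
Lemma exists_almost_invariant (a : R) : 0 < a -> exists D : set X,
  [/\ open D, 4^-1 <= m D <= 2^-1,
      m (D `\` T @^-1` D) <= a & m (T @^-1` D `\` D) <= a].
Proof.
(* With steps below 1/4, the first D_n of measure above 1/4 still has measure at most 1/2. *)
move=> a0; have b0 : 0 < Num.min a (4^-1 : R) by rewrite lt_min a0 invr_gt0 ltr0n.
have [A [oA A0]] := exists_small_open b0; rewrite lt_min => /andP[Aa A4].
pose F k := iter k T @^-1` A.
have oF k : open (F k) by move/continuousP : (@continuous_iter _ _ T k cT); apply.
pose D n := \bigcup_(i < n) F i.
have oD n : open (D n) by apply: bigcup_open.
have mF k : meas (F k) by exact: borel_open.
have mD n : meas (D n) by exact: borel_open.
have DS n : D n.+1 = D n `|` F n by rewrite /D !bigcup_mkord big_ord_recr.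
have [n Dn] : exists n, 4^-1 < m (D n).
  apply: pr_bigcup_gt => //.
    by move=> i j ij x [k /= ki Fk]; exists k => //=; exact: leq_trans ij.
  have -> : \bigcup_n D n = \bigcup_n F n.
    apply/seteqP; split => [x [n _ [k _ Fk]]|x [k _ Fk]]; first by exists k.
    by exists k.+1 => //; exists k => /=.
  by rewrite pr_bigcup_preimage//; [lra | exact: borel_open].
have ex : exists n, 4^-1 < m (D n) by exists n.
(* The least such index is taken; it is not 0, because D_0 is empty. *)
case: (ex_minnP ex) => k; case: k => {n Dn ex} [|n] Dn Dmin.
  by move: Dn; rewrite /D bigcup_mkord big_ord0 /pr measure0 /= ltNge invr_ge0 ler0n.
have Dn4 : m (D n) <= 4^-1.
  by rewrite leNgt; apply/negP => /Dmin; rewrite ltnn.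
have mTD : meas (T @^-1` D n.+1) by exact: borel_preimage.
exists (D n.+1); split => //.
- rewrite ltW//= DS (le_trans (prU _ _ _))// pr_iter//; first lra.
  exact: borel_open.
- rewrite (le_trans _ (ltW Aa))// pr_le//; [exact: measurableD|exact: borel_open|].
  move=> x [[[|k] /= kn Fk] nTD]; first exact: Fk.
  exfalso; apply: nTD; exists k; first exact: ltn_trans kn.
  by move: Fk; rewrite /F/preimage/= -iterS iterSr.
- rewrite (le_trans _ (ltW Aa))// -(pr_iter cT ueT n.+1 (borel_open oA)).
  rewrite pr_le//; [exact: measurableD|exact: mF|].
  move=> x [[k /= kn Fk] nD].
  have Fk1 : F k.+1 x by rewrite /F/preimage/= -iterS iterSr.
  move: kn; rewrite leq_eqVlt => /orP[/eqP kn|kn]; last first.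
    by exfalso; apply: nD; exists k.+1.
  by move: kn => [<-].
Qed.

Lemma integrable_continuous (f : X -> R) : continuous f ->
  mu.-integrable [set: borel X] (EFin \o (f : borel X -> R)).
Proof.
move=> cf; apply: measurable_bounded_integrable => //.
- by rewrite ltey_eq fin_num_measure.
- exact: continuous_borel_measurable.
have /compact_bounded[M [Mr hM]] : compact (range (f : X -> R^o)).
  by apply: continuous_compact => //; exact: continuous_subspaceT.
by exists M; split => // r Mr' x _; apply: hM => //; exists x.
Qed.

Lemma Rintegral_indicator (A : set X) : meas A ->
  \int[mu]_x (\1_A x) = m A.
Proof. by move=> mA; rewrite /Rintegral integral_indic// setIT. Qed.

(** By inner regularity an almost invariant [D] is nearly filled by a compact [C], and [h] is a
    Urysohn function equal to 1 on [C] and 0 off [D]. It repeats its value from x to T x when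
    neither point is in D \ C and both or neither are in [D]. *)
Lemma exists_slow_function (a : R) : 0 < a ->
  exists2 h : X -> R,
    [/\ continuous h, forall x, 0 <= h x <= 1 & 8^-1 <= \int[mu]_x h x <= 2^-1] &
    exists B : set X, [/\ meas B, m B <= a &
      forall x, ~ B x -> (h x = 0 \/ h x = 1) /\ h (T x) = h x].
Proof.
move=> a0; have a40 : 0 < a / 4 by rewrite divr_gt0.
have [D [oD /andP[D4 D2] DT TD]] := exists_almost_invariant a40.
have mD : meas D by exact: borel_open.
(* The exceptional set has four pieces, two of them of the measure of D \ C, so a/4 gives a total of
   at most [a]. The bound 1/8 leaves m C above 1/4 - 1/8, which bounds the mean of [h] from
   below. *)
have eta0 : 0 < Num.min (a / 4) (8^-1 : R) by rewrite lt_min a40 invr_gt0 ltr0n.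
have [C [cC CD]] : exists C, [/\ compact C, C `<=` D &
    m D - Num.min (a / 4) 8^-1 < m C].
  have : ((m D - Num.min (a / 4) 8^-1)%:E < mu D)%E.
    by rewrite prE// lte_fin ltrBlDr ltrDl.
  rewrite (regmu mD).2 => /ereal_sup_gt[_ [C [cC CD] <-]].
  have mC : meas C.
    by apply: borel_closed; apply: compact_closed => //; exact: metric_hausdorff.
  by rewrite prE// lte_fin; exists C.
have clC : closed C by apply: compact_closed => //; exact: metric_hausdorff.
have mC : meas C by exact: borel_closed.
rewrite ltrBlDr -ltrBlDl lt_min => /andP[DCa DC8].
pose h := Urysohn (R := R) (~` D) C.
have sep : uniform_separator (~` D) C.
  apply/(@normal_separatorP R _).1 => //.
  - exact: pseudometric_normal.
  - by rewrite closedC.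
  - by apply/disjoints_subset => x nDx /CD.
have ch : continuous h by exact: Urysohn_continuous.
have h01 x : 0 <= h x <= 1.
  by have /(_ (h x)) := @Urysohn_range _ R (~` D) C;
    rewrite /= in_itv /=; apply; exists x.
have h0 x : ~ D x -> h x = 0.
  by move=> Dx; apply: (Urysohn_sub0 sep); exists x.
have h1 x : C x -> h x = 1.
  by move=> Cx; apply: (Urysohn_sub1 sep); exists x.
exists h.
  split => //; apply/andP; split.
    apply: (@le_trans _ _ (m C)); first lra.
    rewrite -Rintegral_indicator//; apply: le_Rintegral => //.
    - exact: integrable_indic.
    - exact: integrable_continuous.
    move=> x _; rewrite indicE; have [/[!inE] /h1 ->//|_] := boolP (x \in C).
    by have /andP[] := h01 x.
  rewrite (le_trans _ D2)// -Rintegral_indicator//; apply: le_Rintegral => //.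
  - exact: integrable_continuous.
  - exact: integrable_indic.
  move=> x _; rewrite indicE; have [_|/negP nD] := boolP (x \in D).
    by have /andP[] := h01 x.
  by rewrite h0// => Dx; apply: nD; rewrite inE.
have mDC : meas (D `\` C) by exact: measurableD.
have mTD : meas (T @^-1` D) by exact: borel_preimage.
have mTDC : meas (T @^-1` (D `\` C)) by exact: borel_preimage.
have mD1 : meas (D `\` T @^-1` D) by exact: measurableD.
have mD2 : meas (T @^-1` D `\` D) by exact: measurableD.
exists ((D `\` C) `|` T @^-1` (D `\` C) `|`
        ((D `\` T @^-1` D) `|` (T @^-1` D `\` D))); split.
- by apply: measurableU; exact: measurableU.
- rewrite (le_trans (prU _ _ _))//; [exact: measurableU|exact: measurableU|].
  have := prU mu mDC mTDC; have := prU mu mD1 mD2.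
  rewrite (pr_preimage ueT mDC) (prD _ mD mC CD); lra.
move=> x nB.
have nDC : ~ (D `\` C) x by move=> ?; apply: nB; left; left.
have nTDC : ~ (D `\` C) (T x) by move=> ?; apply: nB; left; right.
have nDTD : ~ (D `\` T @^-1` D) x by move=> ?; apply: nB; right; left.
have nTDD : ~ (T @^-1` D `\` D) x by move=> ?; apply: nB; right; right.
have [Dx|nDx] := pselect (D x).
  have TDx : D (T x) by apply: contrapT => ?; apply: nDTD.
  have hx : h x = 1 by apply: h1; apply: contrapT => ?; apply: nDC.
  have hTx : h (T x) = 1 by apply: h1; apply: contrapT => ?; apply: nTDC.
  by split; [right|rewrite hx].
have nTDx : ~ D (T x) by move=> TDx; apply: nTDD.
by split; [left; exact: h0|rewrite !h0].
Qed.

(** Centering works because the mean of the slow function lies between 1/8 and 1/2, so both values 0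
    and 1 are at distance at least 1/8 from it. Off the preimages of the bad set the n summands are
    equal and cannot cancel. *)
Lemma exists_large_sum (a : R) n : 0 < a ->
  exists2 u : X -> R,
    [/\ continuous u, forall x, `|u x| <= 1 & \int[mu]_x u x = 0] &
    exists B : set X, [/\ meas B, m B <= a &
      forall x, ~ B x -> n%:R / 8 <= `|\sum_(i < n) u (iter i T x)|].
Proof.
(* The bad set is pulled back n times, at a total cost of n a/(n+1); using n+1 also covers n = 0. *)
move=> a0; have an0 : 0 < a / n.+1%:R by rewrite divr_gt0.
have [h [ch h01 /andP[I8 I2]] [B [mB Ba hB]]] := exists_slow_function an0.
set c := \int[mu]_x h x in I8 I2.
have mF i : meas (iter i T @^-1` B) by exact: borel_iter.
exists (fun x => h x - c).
  split=> [x|x|].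
  - by apply: cvgB; [exact: ch|exact: cvg_cst].
  - by have /andP[? ?] := h01 x; rewrite ler_norml; lra.
  rewrite RintegralB//; last 2 first.
  - exact: integrable_continuous.
  - by apply: integrable_continuous => x; exact: cvg_cst.
  rewrite Rintegral_cst//.
  have -> : fine (mu [set: borel X]) = 1 by rewrite probability_setT.
  by rewrite mulr1 -/c subrr.
exists (\bigcup_(i < n) (iter i T @^-1` B)); split.
- by apply: bigcup_measurable => i _; exact: mF.
- rewrite bigcup_mkord; apply: le_trans (pr_bigcup_ord (c := a / n.+1%:R) _ mF _) _.
    by move=> i; rewrite pr_iter.
  by rewrite mulrCA ger_pMr// ler_pdivrMr// mul1r ler_nat.
move=> x nB.
(* For n = 0 the union of preimages is empty and says nothing about x, but the bound is then
   trivial. *)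
case: n an0 Ba mF nB => [|n] an0 Ba mF nB; first by rewrite mul0r.
have orb i : (i < n.+1)%N -> h (iter i T x) = h x.
  elim: i => // i IH i_n; rewrite iterS -(IH (ltnW i_n)).
  by apply: (hB _ _).2 => Bi; apply: nB; exists i => //=; exact: ltnW.
under eq_bigr => i _ do rewrite orb//.
rewrite sumr_const card_ord normrMn -[leRHS]mulr_natl ler_wpM2l//.
have nBx : ~ B x by move=> Bx; apply: nB; exists 0%N.
have [[hx|hx] _] := hB x nBx; rewrite hx.
  rewrite sub0r normrN ger0_norm; lra.
by rewrite ger0_norm; lra.
Qed.

End almost_invariant.

(** * Moduli, continuity and integrals, uniformly in the real and complex cases *)

Section scalars.
Context (R : realType).

Definition of_real (k : scalar_kind) : R -> scalar_field R k :=
  match k with RealScalars => id | ComplexScalars => real_complex R end.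

Lemma of_realD k (a b : R) : of_real k (a + b) = of_real k a + of_real k b.
Proof. by case: k => //=; rewrite raddfD. Qed.

Lemma of_real_sum k n (F : 'I_n -> R) :
  of_real k (\sum_(i < n) F i) = \sum_(i < n) of_real k (F i).
Proof. by case: k => //=; rewrite raddf_sum. Qed.

Lemma sabs_of_real k (r : R) : sabs (of_real k r) = `|r|.
Proof. by case: k => //=; rewrite expr0n addr0 sqrtr_sqr. Qed.

(** In the complex case the radii of balls are themselves complex; a positive one has zero imaginary
    part, so real radii suffice. *)
Lemma continuous_sabsP k (X : topologicalType) (F : X -> scalar_field R k) :
  continuous F <->
  forall x e, 0 < e -> \forall y \near x, sabs (F x - F y) < e.
Proof.
split=> [cF x e e0|cF x A]; first exact: cF (nbhs_sabs (F x) e0).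
case: k F cF A => F cF A /nbhs_ballP[e /= e0 eA].
  by near=> y; apply: eA; rewrite /ball /=; near: y; exact: cF.
have [er ei] : 0 < complex.Re e /\ complex.Im e = 0.
  by move: e0; rewrite ltcE /= => /andP[/eqP].
near=> y; apply: eA; rewrite /ball /= ltcE /= ei eqxx /=.
by near: y; exact: cF.
Unshelve. all: by end_near. Qed.

Lemma sabs_dist k (z w : scalar_field R k) : `|sabs z - sabs w| <= sabs (z - w).
Proof.
rewrite ler_norml; have := sabsD (z - w) w; have := sabsD (w - z) z.
by rewrite !subrK (sabsB w z); lra.
Qed.

Lemma sabs_sum k n (F : 'I_n -> scalar_field R k) :
  sabs (\sum_(i < n) F i) <= \sum_(i < n) sabs (F i).
Proof.
elim/big_ind2 : _ => [|a b c d ab cd|//]; first by rewrite sabs0.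
exact: le_trans (sabsD _ _) (lerD ab cd).
Qed.

Lemma continuous_sabs k (X : topologicalType) (F : X -> scalar_field R k) :
  continuous F -> continuous (fun x => sabs (F x)).
Proof.
move=> /continuous_sabsP cF x; apply/cvgrPdist_lt => e e0.
near=> y; apply: le_lt_trans (sabs_dist _ _) _.
by near: y; exact: cF.
Unshelve. all: by end_near. Qed.

Lemma continuous_sum_scalar k (X : topologicalType) n
    (F : 'I_n -> X -> scalar_field R k) :
  (forall i, continuous (F i)) -> continuous (fun x => \sum_(i < n) F i x).
Proof.
move=> cF; apply/continuous_sabsP => x e e0.
have en0 : 0 < e / n.+1%:R by rewrite divr_gt0.
have /filter_forall : forall i : 'I_n,
    \forall y \near x, sabs (F i x - F i y) < e / n.+1%:R.
  by move=> i; move/continuous_sabsP : (cF i); exact.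
apply: filterS => y Fy; rewrite -sumrB; apply: le_lt_trans (sabs_sum _) _.
apply: (@le_lt_trans _ _ (\sum_(i < n) e / n.+1%:R)).
  by apply: ler_sum => i _; exact: ltW.
rewrite sumr_const card_ord -[ltLHS]mulr_natl mulrCA gtr_pMr//.
by rewrite ltr_pdivrMr// mul1r ltr_nat.
Qed.

Lemma continuousD_of_real k (X : topologicalType) (F : X -> scalar_field R k)
    (u : X -> R) : continuous F -> continuous u ->
  continuous (fun x => F x + of_real k (u x)).
Proof.
move=> /continuous_sabsP cF cu; apply/continuous_sabsP => x e e0.
have e20 : 0 < e / 2 by rewrite divr_gt0.
have cux : \forall y \near x, `|u x - u y| < e / 2.
  by move/cvgrPdist_lt : (cu x); exact.
near=> y; have -> : F x + of_real k (u x) - (F y + of_real k (u y)) =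
    F x - F y + of_real k (u x - u y).
  have -> : of_real k (u x) = of_real k (u x - u y) + of_real k (u y).
    by rewrite -of_realD subrK.
  ring.
apply: le_lt_trans (sabsD _ _) _; rewrite sabs_of_real.
have : sabs (F x - F y) < e / 2 by near: y; exact: cF.
have : `|u x - u y| < e / 2 by near: y.
lra.
Unshelve. all: by end_near. Qed.

Lemma continuous_Re_Im (X : topologicalType)
    (F : X -> scalar_field R ComplexScalars) : continuous F ->
  continuous (fun x => complex.Re (F x)) /\ continuous (fun x => complex.Im (F x)).
Proof.
move=> /continuous_sabsP cF.
have le_sabs (z : R[i]) :
    `|complex.Re z| <= @sabs R ComplexScalars z /\
    `|complex.Im z| <= @sabs R ComplexScalars z.
  case: z => a b; rewrite /= -!sqrtr_sqr.
  by split; apply: ler_wsqrtr; rewrite ?lerDl ?lerDr sqr_ge0.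
split=> x; apply/cvgrPdist_lt => e e0; near=> y;
  apply: (@le_lt_trans _ _ (sabs (F x - F y))).
- by have [+ _] := le_sabs (F x - F y); rewrite raddfB.
- by near: y; exact: cF.
- by have [_ +] := le_sabs (F x - F y); rewrite raddfB.
- by near: y; exact: cF.
Unshelve. all: by end_near. Qed.

(** In the complex case a real perturbation affects only the real part of the integral, which
    changes by the integral of [u], that is, by 0. *)
Lemma sintegralD_of_real k (X : pmetricType R) (cX : compact [set: X])
    (mu : probability (borel X) R) (f : X -> scalar_field R k) (u : X -> R) :
  continuous f -> continuous u -> \int[mu]_x u x = 0 ->
  Defs.sintegral (k := k) mu (fun x : borel X => f x + of_real k (u x)) =
  Defs.sintegral (k := k) mu f.
Proof.
have intD (g : X -> R) : continuous g -> continuous u -> \int[mu]_x u x = 0 ->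
    \int[mu]_x (g x + u x) = \int[mu]_x g x.
  move=> cg cu u0; rewrite RintegralD ?u0 ?addr0//; exact: integrable_continuous.
case: k f => f cf cu u0 /=; first exact: intD.
have [cr ci] := continuous_Re_Im cf; congr Complex.
  by rewrite -[RHS]intD//; apply: eq_Rintegral => x _; rewrite raddfD.
by apply: eq_Rintegral => x _; rewrite raddfD /= addr0.
Qed.

End scalars.

(** * The growth set as a decreasing intersection of open sets *)

Section large_sums.
Context (R : realType) (k : scalar_kind) (X : pmetricType R).
Context (T : X -> X) (psi : nat -> nat).
Hypotheses (cT : continuous T) (psi_gt0 : forall n, (0 < n)%N -> (0 < psi n)%N).
Implicit Type f : X -> scalar_field R k.

(** The condition [i < n] matches the tails in the limsup and keeps [n] positive, where [psi] is
    positive. *)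
Definition large_sums f (i : nat) : set X :=
  [set x | exists2 n, (i < n)%N &
    i%:R * (psi n)%:R < sabs (birkhoff_sum T f n x)].

Lemma continuous_birkhoff_sum f n : continuous f ->
  continuous (birkhoff_sum T f n).
Proof.
move=> cf; apply: continuous_sum_scalar => i x.
by apply: continuous_comp; [exact: continuous_iter|exact: cf].
Qed.

Lemma open_birkhoff_gt f n (c : R) : continuous f ->
  open [set x | c < sabs (birkhoff_sum T f n x)].
Proof.
move=> cf; have /continuousP := continuous_sabs (@continuous_birkhoff_sum f n cf).
by move=> /(_ _ (@open_gt R c)).
Qed.

Lemma open_large_sums f i : continuous f -> open (large_sums f i).
Proof.
move=> cf; have -> : large_sums f i = \bigcup_(n in [set n | (i < n)%N])
    [set x | i%:R * (psi n)%:R < sabs (birkhoff_sum T f n x)].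
  by apply/seteqP; split=> x [n]; exists n.
by apply: bigcup_open => n _; exact: open_birkhoff_gt.
Qed.

Lemma large_sums_anti f i j : (i <= j)%N -> large_sums f j `<=` large_sums f i.
Proof.
move=> ij x [n jn h]; exists n; first exact: leq_ltn_trans jn.
by apply: le_lt_trans h; rewrite ler_wpM2r// ler_nat.
Qed.

Lemma growth_setE f : growth_set T psi f = \bigcap_i large_sums f i.
Proof.
apply/seteqP; split => x; rewrite /growth_set /=;
  pose r n := ((sabs (birkhoff_sum T f n x) / (psi n)%:R)%:E : \bar R);
  rewrite -/r.
  move=> rx i _.
  (* The limsup is at most the supremum over the tail n > i, which is therefore infinite and exceeds
     [i] at some index. *)
  have : (limn_esup r <= ereal_sup (r @` [set n | (i < n)%N]))%E.
    by apply: ereal_inf_lbound; exists [set n | (i < n)%N] => //; exists i.+1.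
  rewrite rx => /(lt_le_trans (ltry i%:R)).
  move=> /ereal_sup_gt[_ [n /= ni <-]]; rewrite lte_fin => h.
  exists n => //; rewrite -ltr_pdivlMr// ltr0n psi_gt0//.
  exact: leq_ltn_trans ni.
move=> Lx; apply/eqyP => M M0; apply: le_ereal_inf_tmp => _ [V [N _ NV] <-].
(* The same index serves twice: it puts n beyond [N], hence in [V], and makes the ratio exceed
   [M]. *)
have [n nN] := Lx (maxn N (Num.trunc M).+1) I.
rewrite -ltr_pdivlMr; last first.
  by rewrite ltr0n psi_gt0//; exact: leq_ltn_trans nN.
move=> h. apply: (@le_trans _ _ (r n)).
  rewrite lee_fin ltW//; apply: le_lt_trans h.
  rewrite (le_trans (ltW (truncnS_gt M)))// ler_nat.
  exact: leq_maxr.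
apply: ereal_sup_ubound; exists n => //; apply: NV => /=.
by apply: ltnW; apply: leq_ltn_trans nN; exact: leq_maxl.
Qed.

End large_sums.

(** * Openness and density of the functions whose sums are large on most points *)

Section generic.
Context (R : realType) (k : scalar_kind) (X : pmetricType R).
Context (cX : compact [set: X]) (T : X -> X) (cT : continuous T).
Context (mu : probability (borel X) R).
Context (psi : nat -> nat).
Local Notation C0 := (C0 k cX mu).
Local Notation m := (pr mu).
Local Notation L := (large_sums T psi).

Definition mostly_large (i : nat) : set C0 :=
  [set f : C0 | 1 - i.+1%:R^-1 < m (L f i)].

Lemma sabs_le_mdist (f g : C0) x : sabs (f x - g x) <= mdist f g.
Proof.
by rewrite C0_mdistE; apply: ub_le_sup; [exact: C0_has_ubound|exists x].
Qed.

Lemma mdist_le (f g : C0) (r : R) :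
  (forall x, sabs (f x - g x) <= r) -> mdist f g <= r.
Proof.
move=> h; rewrite C0_mdistE; apply: ge_sup.
  by exists (sabs (f point - g point)); exists point.
by move=> _ [x _ <-].
Qed.

Lemma birkhoff_sum_mdist (f g : C0) n x :
  sabs (birkhoff_sum T f n x - birkhoff_sum T g n x) <= n%:R * mdist f g.
Proof.
rewrite /birkhoff_sum -sumrB; apply: le_trans (sabs_sum _) _.
apply: (@le_trans _ _ (\sum_(i < n) mdist f g)).
  by apply: ler_sum => i _; exact: sabs_le_mdist.
by rewrite sumr_const card_ord mulr_natl.
Qed.

(** The set of large sums is exhausted by the sets [V j], which involve only n <= j and demand a
    margin 1/(j+1). One of them already has enough measure, and its finitely many sums survive a
    small uniform change of [f]. *)
Lemma open_mostly_large i : open (mostly_large i).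
Proof.
rewrite openE => f fi; pose p (j : nat) : R := j.+1%:R^-1.
pose V j := \bigcup_(n in [set n | (i < n <= j)%N])
  [set x | i%:R * (psi n)%:R + p j < sabs (birkhoff_sum T f n x)].
have oV j : open (V j).
  by apply: bigcup_open => n _; apply: open_birkhoff_gt => //; exact: C0_continuous.
have VL : L f i `<=` \bigcup_j V j.
  move=> x [n ni h].
  have h0 : 0 < sabs (birkhoff_sum T f n x) - i%:R * (psi n)%:R by rewrite subr_gt0.
  have [N _ Nh] := near_infty_natSinv_lt (PosNum h0).
  exists (maxn n N) => //; exists n; first by rewrite /= ni leq_maxl.
  by rewrite /= -ltrBrDl; apply: Nh; rewrite /= leq_maxr.
have [j|a b ab||j Vj] := @pr_bigcup_gt _ _ _ mu V (1 - i.+1%:R^-1).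
- exact: borel_open.
- move=> x [n /= /andP[ni na] h]; exists n.
    by rewrite /= ni (leq_trans na).
  apply: le_lt_trans h; rewrite lerD2l lef_pV2 ?posrE// ler_nat.
  by [].
- apply: (lt_le_trans fi); apply: pr_le => //.
    by apply: borel_open; apply: open_large_sums => //; exact: C0_continuous.
  by apply: borel_open; exact: bigcup_open.
(* Within this radius, each sum of at most [j] terms moves by at most the margin [p j]. *)
have e0 : 0 < p j / j.+1%:R by rewrite divr_gt0// invr_gt0.
apply/nbhs_ballP; exists (p j / j.+1%:R) => //= g.
rewrite ballEmdist /= => fg; apply: (lt_le_trans Vj); apply: pr_le.
- exact: borel_open.
- by apply: borel_open; apply: open_large_sums => //; exact: C0_continuous.
move=> x [n /= /andP[ni nj] h]; exists n => //.
have d1 := birkhoff_sum_mdist f g n x.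
have d2 : n%:R * mdist f g <= p j.
  apply: (@le_trans _ _ (j.+1%:R * (p j / j.+1%:R))).
    apply: ler_pM => //; [exact: mdist_ge0|by rewrite ler_nat leqW|exact: ltW].
  by rewrite mulrC divfK.
have := sabsD (birkhoff_sum T f n x - birkhoff_sum T g n x) (birkhoff_sum T g n x).
by rewrite subrK; lra.
Qed.

Hypotheses (ueT : uniquely_ergodic T mu) (regmu : regular_measure mu).
Hypotheses (contmu : continuous_measure mu) (suppmu : full_support mu).
Hypothesis (psi_o : (fun n => (psi n)%:R : R) =o_\oo (fun n => n%:R : R)).

Definition C0_perturb (f : C0) (u : X -> R) (cu : continuous u)
    (u0 : \int[mu]_x u x = 0) : C0 :=
  MkC0 cX (continuousD_of_real (C0_continuous (c := f)) cu)
    (etrans (sintegralD_of_real cX (C0_continuous (c := f)) cu u0) (C0_mean0 f)).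

Lemma exists_psi_small (c : R) i : 0 < c ->
  exists2 n, (i < n)%N & (psi n)%:R <= c * n%:R :> R.
Proof.
move=> c0; have /eqoP/(_ c c0)[N _ hN] := psi_o.
exists (maxn i.+1 N); first by rewrite leq_maxl.
by have := hN (maxn i.+1 N); rewrite /= !normr_nat; apply; rewrite leq_maxr.
Qed.

(* Any two of the J perturbations f + (j e / J) u have n-th Birkhoff sums
   differing by more than 2 i psi(n) wherever the n-th sum of u is at least n/8,
   so at such a point at most one of them fails to exceed i psi(n); by
   pigeonhole one of them fails only on a set of measure about 1/J. *)
Lemma dense_mostly_large i : dense (mostly_large i).
Proof.
move=> O [f Of] oO.
have /nbhs_ballP[e /= e0 eO] : nbhs f O by exact: open_nbhs_nbhs.
(* The failure set is covered by [B], of measure at most [q], and some [F j], of measure at most 1/J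
   < q; the total is below 2q = 1/(i+1). *)
pose J := (2 * i.+1).+1; pose q : R := (2 * i.+1)%:R^-1.
have q0 : 0 < q by rewrite invr_gt0 ltr0n.
have qi : q + q = i.+1%:R^-1.
  by rewrite /q natrM invfM -mulrDl -[RHS]mul1r; congr (_ * _); lra.
(* This step size keeps all [J] perturbations within e/2 of [f]. *)
pose s : R := e / 2 / J%:R.
have s0 : 0 < s by rewrite !divr_gt0.
have sJ : J%:R * s = e / 2 by rewrite /s mulrC divfK// pnatr_eq0.
clearbody s.
(* Here 16 = 2 * 8: the bound on psi(n) gives 2 i psi(n) <= (s n/8) i/(i+1), which is strictly below
   the least gap s n/8 between two perturbed sums off [B]. *)
have c0 : 0 < s / 16 / i.+1%:R by rewrite divr_gt0// divr_gt0.
have [n ni psin] := exists_psi_small i c0.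
have [u [cu u1 u0] [B [mB Bq hB]]] :=
  exists_large_sum cX cT ueT regmu contmu suppmu n q0.
have cju (j : nat) : continuous (fun x => j%:R * s * u x).
  by move=> x; apply: cvgM; [exact: cvg_cst|exact: cu].
have ju0 (j : nat) : \int[mu]_x (j%:R * s * u x) = 0.
  rewrite RintegralZl//; last exact: integrable_continuous.
  by rewrite u0 mulr0.
pose g j : C0 := C0_perturb f (cju j) (ju0 j).
pose U x := \sum_(l < n) u (iter l T x).
have gE j x : birkhoff_sum T (g j) n x =
    birkhoff_sum T f n x + of_real k (j%:R * s * U x).
  by rewrite /birkhoff_sum big_split /= mulr_sumr of_real_sum.
pose F j := [set x | sabs (birkhoff_sum T (g j) n x) <= i%:R * (psi n)%:R] `\` B.
have mF0 j : measurable
    ([set x | sabs (birkhoff_sum T (g j) n x) <= i%:R * (psi n)%:R] : set (borel X)).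
  apply: borel_closed; rewrite -openC.
  have -> : ~` [set x | sabs (birkhoff_sum T (g j) n x) <= i%:R * (psi n)%:R] =
      [set x | i%:R * (psi n)%:R < sabs (birkhoff_sum T (g j) n x)].
    by apply/seteqP; split=> x /=; rewrite ltNge => /negP.
  by apply: open_birkhoff_gt => //; exact: C0_continuous.
have mF j : measurable (F j : set (borel X)) by exact: measurableD.
have psi_s : i%:R * (psi n)%:R * 2 < s * (n%:R / 8).
  have n0 : 0 < n%:R :> R by rewrite ltr0n; exact: leq_ltn_trans ni.
  apply: (@le_lt_trans _ _ (i%:R * (s / 16 / i.+1%:R * n%:R) * 2)).
    by rewrite ler_wpM2r// ler_wpM2l.
  have -> : i%:R * (s / 16 / i.+1%:R * n%:R) * 2 =
      (s * (n%:R / 8)) * (i%:R / i.+1%:R).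
    by set v : R := i.+1%:R^-1; field.
  rewrite gtr_pMr; last by rewrite mulr_gt0// divr_gt0.
  by rewrite ltr_pdivrMr// mul1r ltr_nat.
have tF : trivIset `I_J F.
  have dis a b x : (a < b)%N -> F a x -> F b x -> False.
    move=> ab [/= Fa nB] [/= Fb _].
    have := sabsD (birkhoff_sum T (g b) n x) (- birkhoff_sum T (g a) n x).
    have -> : sabs (- birkhoff_sum T (g a) n x) = sabs (birkhoff_sum T (g a) n x).
      by rewrite -[in LHS]sub0r sabsB subr0.
    have -> : birkhoff_sum T (g b) n x - birkhoff_sum T (g a) n x =
        of_real k ((b - a)%:R * s * U x).
      rewrite natrB ?(ltnW ab)// mulrBl mulrBl !gE.
      have -> : of_real k (b%:R * s * U x) =
        of_real k (b%:R * s * U x - a%:R * s * U x) + of_real k (a%:R * s * U x).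
        by rewrite -of_realD subrK.
      ring.
    rewrite sabs_of_real !normrM normr_nat (gtr0_norm s0).
    apply/negP; rewrite -ltNge; apply: (@le_lt_trans _ _ (i%:R * (psi n)%:R * 2)).
      lra.
    apply: (lt_le_trans psi_s); rewrite -mulrA.
    apply: (@le_trans _ _ (1 * (s * `|U x|))).
      by rewrite mul1r; apply: ler_wpM2l; [exact: ltW|exact: hB].
    by rewrite ler_wpM2r ?mulr_ge0 ?(ltW s0)// ler1n subn_gt0.
  move=> a b _ _ [x [Fa Fb]]; have [ab|ba|//] := ltngtP a b; exfalso.
    exact: (dis a b x ab Fa Fb).
  exact: (dis b a x ba Fb Fa).
have [j jJ Fj] := @pr_trivIset_pigeonhole _ _ _ mu F J isT mF tF.
exists (g j); split; last first.
  rewrite /mostly_large /=.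
  have mL : measurable (L (g j) i : set (borel X)).
    by apply: borel_open; apply: open_large_sums => //; exact: C0_continuous.
  have : m (~` L (g j) i) <= m (F j `|` B).
    apply: pr_le; [exact: measurableC|exact: measurableU|].
    move=> x nLx; have [Bx|nBx] := pselect (B x); [by right|left; split => //=].
    by rewrite leNgt; apply/negP => h; apply: nLx; exists n.
  have := prU mu (mF j) mB.
  have : J%:R^-1 < q by rewrite ltf_pV2 ?posrE// ltr_nat.
  by rewrite prC// -qi; lra.
apply: eO; rewrite ballEmdist /=; apply: (@le_lt_trans _ _ (e / 2)); last lra.
apply: mdist_le => x; rewrite sabsB /= addrC addKr sabs_of_real !normrM normr_nat.
rewrite (gtr0_norm s0); apply: (@le_trans _ _ (J%:R * s * 1)).
  apply: ler_pM => //; first by rewrite mulr_ge0// ltW.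
  by rewrite ler_wpM2r ?ltW// ltr_nat.
by rewrite mulr1 sJ.
Qed.

End generic.

(** * Residuality and full measure of the growth set for generic functions *)

Theorem theorem1p1 (R : realType) (k : scalar_kind) (Omega : pmetricType R)
    (cOmega : compact [set: Omega]) (iOmega : infinite_set [set: Omega])
    (T : Omega -> Omega) (bT : bijective T) (cT : continuous T)
    (mu : probability (borel Omega) R) (ueT : uniquely_ergodic T mu)
    (regmu : regular_measure mu) (contmu : continuous_measure mu)
    (suppmu : full_support mu)
    (psi : nat -> nat) (psi_gt0 : forall n, (0 < n)%N -> (0 < psi n)%N)
    (psi_o : (fun n => (psi n)%:R : R) =o_\oo (fun n => n%:R : R)) :
  exists Res : set (C0 k cOmega mu), residual Res /\
    forall f, Res f ->
      residual (growth_set T psi f) /\ full_measure mu (growth_set T psi f).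
Proof.
pose W := @mostly_large R k Omega cOmega T mu psi.
exists (\bigcap_i W i); split.
  exists (\bigcap_i W i) => //; exists W => // i.
  by split; [exact: open_mostly_large|exact: dense_mostly_large].
move=> f Wf; rewrite growth_setE//.
have oL i : open (large_sums T psi f i).
  by apply: open_large_sums => //; exact: C0_continuous.
have mL i : measurable (large_sums T psi f i : set (borel Omega)).
  exact: borel_open.
(* The sets decrease in their index, so the i-th one has measure above 1 - 1/(N+1) for every N >=
   i. *)
have L1 i : pr mu (large_sums T psi f i) = 1.
  apply/eqP; rewrite eq_le pr_le1//= leNgt; apply/negP => Li.
  have d0 : 0 < 1 - pr mu (large_sums T psi f i) by rewrite subr_gt0.
  have [N _ Nd] := near_infty_natSinv_lt (PosNum d0).
  have := Nd (maxn i N) (leq_maxr _ _); have := Wf (maxn i N) I.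
  have := pr_le mu (mL (maxn i N)) (mL i) (large_sums_anti (leq_maxl _ _)).
  move=> le_pr lt_pr lt_inv; have := lt_le_trans lt_pr le_pr.
  by rewrite ltrBlDr -ltrBlDl ltNge (ltW lt_inv).
split.
  exists (\bigcap_i large_sums T psi f i) => //.
  exists (large_sums T psi f) => // i; split => // O [x Ox] oO.
  apply/set0P/eqP => OL0; have := open_pr_gt0 suppmu oO Ox.
  have : pr mu O <= pr mu (~` large_sums T psi f i).
    apply: pr_le; [exact: borel_open|exact: measurableC|].
    exact/disjoints_subset.
  by rewrite prC// L1 subrr => /le_lt_trans h /h; rewrite ltxx.
have mI : measurable (\bigcap_i large_sums T psi f i : set (borel Omega)).
  exact: bigcapT_measurable.
split => //; rewrite prE//; congr EFin.
apply/eqP; rewrite eq_le pr_le1//= leNgt; apply/negP => lt1.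
(* By continuity from above, an intersection of measure below 1 would force one of the sets to have
   measure below 1. *)
have [i j ij|n] := pr_bigcap_lt mL _ lt1.
  exact: large_sums_anti.
by rewrite L1 ltxx.
Qed.
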